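(* Let $I$ be a set, $n$ a positive integer, and for every $i\in I$ let $F_1^i,\ldots,F_n^i$ be finite subsets of $S$. For $i\in I$ put $F^i=\bigcup_{k=1}^nF_k^i$ and let $\mathcal{F}=\{F^i\mid i\in I\}$. Assume that for every $F$ in the closure of $\mathcal{F}$ in $\mathcal{P}(S)$ and for every chain $\beta\in\mathcal{C}(S)$, the set $F\cap\beta$ is finite. Then there exists a subtree $T$ of $S$ with the following property: for every chain $\beta=(s_j)_{j=1}^\infty\in\mathcal{C}(T)$, every $i\in I$, every $q\in\mathbb{N}$, every $k\in\{1,\ldots,n\}$ and every $A\subseteq F_k^i\cap\{s_1,\ldots,s_q\}$, there exists $i'\in I$ such that (i) $F_k^{i'}\cap\{s_1,\ldots,s_q\}=A$; and (ii) $F_{k'}^{i'}\cap\{s_1,\ldots,s_q\}\subseteq A$ for every $k'\in\{1,\ldots,n\}$ with $k'\neq k$.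
   Context: $S=\bigcup_{n=0}^\infty\{0,1\}^n$ is the dyadic tree of all finite sequences in $\{0,1\}$ (including the empty one), partially ordered by the initial segment relation $\le$. A subtree of $S$ is a subset $T\subseteq S$, with the induced order, which has a single minimal element and in which every element has exactly two immediate successors (i.e. for each $t\in T$ there are exactly two minimal elements of $\{t'\in T: t<t'\}$); thus $T$ is order isomorphic to $S$. A chain of a tree $T$ is an infinite linearly ordered subset of $T$; $\mathcal{C}(T)$ is the set of all chains of $T$. A chain is written $\beta=(s_j)_{j=1}^\infty$ with its elements enumerated increasingly, $s_1<s_2<\cdots$. The power set $\mathcal{P}(S)$ is identified with $\{0,1\}^S$ and carries the product topology (topology of pointwise convergence of characteristic functions). *)

(* Defs.v *)
From mathcomp Require Export all_boot.
From mathcomp Require Export all_classical.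
From mathcomp Require Export topology.

Set Implicit Arguments.
Unset Strict Implicit.
Unset Printing Implicit Defensive.

Local Open Scope classical_set_scope.

(* The dyadic tree S. Its order is the initial segment relation [prefix] of
   seq.v, not one of the (product, lexicographic) orders that MathComp attaches
   to aliases of [seq]. *)
Definition dyadic : Type := seq bool.

Definition tree_le (s t : dyadic) : bool := prefix s t.

Definition tree_lt (s t : dyadic) : bool := tree_le s t && (s != t).

Definition minimal_elements (A : set dyadic) : set dyadic :=
  [set m | A m /\ forall a, A a -> tree_le a m -> a = m].

Definition immediate_successors (T : set dyadic) (t : dyadic) : set dyadic :=
  minimal_elements [set t' | T t' /\ tree_lt t t'].

Definition subtree (T : set dyadic) : Prop :=
  (exists! r, minimal_elements T r) /\
  (forall t, T t -> exists a b, a <> b /\ immediate_successors T t = [set a; b]).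

(* The elements of C(T): chains are infinite, but need not be maximal. *)
Definition chains (T : set dyadic) : set (set dyadic) :=
  [set beta | [/\ beta `<=` T, total_on beta tree_le & infinite_set beta]].

(* Numbering starts at 0: [s j] is the element usually written s_(j+1). *)
Definition increasing_enumeration (beta : set dyadic) (s : nat -> dyadic) : Prop :=
  (forall j, tree_lt (s j) (s j.+1)) /\ range s = beta.

(* The bijection identifying P(S) with {0,1}^S, where {0,1} is discrete and
   {0,1}^S has the product topology. *)
Definition char_fun (A : set dyadic) : {ptws dyadic -> bool} := fun s => s \in A.

Definition powerset_closure (FF : set (set dyadic)) : set (set dyadic) :=
  char_fun @^-1` closure (char_fun @` FF).

(* Main.v *)
Require Import Defs.
From mathcomp Require Import all_boot all_classical topology.
Set Implicit Arguments.
Unset Strict Implicit.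
Unset Printing Implicit Defensive.
Local Open Scope classical_set_scope.

(* Call a finite chain [s] with a reservoir [R] above it adequate if every
   [A ++ C] contained in some F_k^i, with [A] a subset of [s] and [C] a finite
   chain of [R], is contained in some F_k^i' such that F^i' meets [s] inside
   [A]. A fusion that preserves adequacy produces the subtree. To add an element
   [m] to [s] one must be able to avoid [m] when it does not belong to [A], and
   for this [R] is thinned out by the Nash-Williams-Galvin dichotomy for chains:
   either no chain [m :: C] of the new reservoir is an obstruction, or every
   infinite chain l_0, l_1, ... begins with one. In the second case, apply this
   to the chains l_j, l_r, l_(r+1), ... for all j < r: a member F^i containing
   the longest of the obstructing tails contains all of l_0, ..., l_(r-1). By
   compactness this is impossible for large r, since no set in the closure of
   the family contains the whole chain. *)

(** * The initial segment order on the dyadic tree *)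

Lemma tree_le_size_eq (s t : dyadic) :
  tree_le s t -> (size t <= size s)%N -> s = t.
Proof.
by move=> /prefixP[u ->]; rewrite size_cat -{2}[size s]addn0 leq_add2l leqn0
  size_eq0 => /eqP->; rewrite cats0.
Qed.

Lemma tree_le_anti (s t : dyadic) : tree_le s t -> tree_le t s -> s = t.
Proof. by move=> st /size_prefix; apply: tree_le_size_eq. Qed.

Lemma tree_lt_irr : irreflexive tree_lt.
Proof. by move=> s; rewrite /tree_lt eqxx andbF. Qed.

Lemma tree_ltW (s t : dyadic) : tree_lt s t -> tree_le s t.
Proof. by case/andP. Qed.

Lemma tree_lt_le_trans (s t u : dyadic) :
  tree_lt s t -> tree_le t u -> tree_lt s u.
Proof.
move=> /andP[st nst] tu; apply/andP; split; first exact: prefix_trans st tu.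
by apply: contraNneq nst => su; apply/eqP/tree_le_anti; rewrite // su.
Qed.

Lemma tree_lt_trans : transitive tree_lt.
Proof. by move=> t s u st /tree_ltW; apply: tree_lt_le_trans. Qed.

Lemma tree_le_eqVlt (s t : dyadic) : tree_le s t -> s = t \/ tree_lt s t.
Proof.
by move=> st; case: (eqVneq s t) => [|n]; [left|right; apply/andP].
Qed.

Lemma tree_le_total_below (s t u : dyadic) :
  tree_le s u -> tree_le t u -> tree_le s t \/ tree_le t s.
Proof.
rewrite /tree_le !prefixE => /eqP<- /eqP<-.
case: (leqP (size s) (size t)) => [st|/ltnW ts]; [left|right].
  by rewrite -(minn_idPl st) take_min -prefixE prefix_take.
by rewrite -(minn_idPl ts) take_min -prefixE prefix_take.
Qed.

(** A strictly increasing list is determined by its set of entries, so [c] is [s] filtered by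
    membership in [c]. *)
Lemma sorted_tree_lt_subseq (c s : seq dyadic) :
  sorted tree_lt c -> sorted tree_lt s -> {subset c <= s} -> subseq c s.
Proof.
move=> sc ss cs; suff -> : c = [seq x <- s | x \in c] by apply: filter_subseq.
apply: (irr_sorted_eq tree_lt_trans tree_lt_irr) => //.
  exact: (sorted_filter tree_lt_trans).
by move=> x; rewrite mem_filter; case: (boolP (x \in c)) => // /cs.
Qed.

Lemma sorted_tree_lt_le_last (s : seq dyadic) (t x : dyadic) :
  sorted tree_lt (rcons s t) -> x \in rcons s t -> tree_le x t.
Proof.
rewrite -cats1 (sorted_pairwise tree_lt_trans) pairwise_cat allrel1r cats1.
case/andP=> /allP st _; rewrite mem_rcons inE => /orP[/eqP->|/st/tree_ltW //].
exact: prefix_refl.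
Qed.

Definition incomparable (s t : dyadic) : Prop :=
  ~ tree_le s t /\ ~ tree_le t s.

Lemma incomparable_le (s t s' t' : dyadic) :
  incomparable s t -> tree_le s s' -> tree_le t t' -> incomparable s' t'.
Proof.
move=> [st ts] ss' tt'; split=> le'.
  by case: (tree_le_total_below (prefix_trans ss' le') tt').
by case: (tree_le_total_below (prefix_trans tt' le') ss').
Qed.

Lemma incomparable_rcons (u : dyadic) (b : bool) :
  incomparable (rcons u b) (rcons u (~~ b)).
Proof.
by split; rewrite /tree_le prefixE !size_rcons -[(size u).+1](size_rcons u b)
  ?size_rcons take_oversize ?size_rcons // eqseq_rcons eqxx; case: b.
Qed.

Lemma tree_lt_rcons (u : dyadic) (b : bool) : tree_lt u (rcons u b).
Proof.
rewrite /tree_lt /tree_le prefix_rcons /=; apply/eqP => /(congr1 size)/eqP.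
by rewrite size_rcons -[X in X == _]addn0 -addn1 eqn_add2l.
Qed.

Lemma tree_lt_rconsP (u v : dyadic) :
  tree_lt u v -> exists b, tree_le (rcons u b) v.
Proof.
move=> /andP[/prefixP[[|b w] ->]]; first by rewrite cats0 eqxx.
by exists b; rewrite -cat_rcons; apply: prefix_prefix.
Qed.

Lemma tree_le_rcons (v u : dyadic) (b : bool) :
  tree_le v (rcons u b) -> v = rcons u b \/ tree_le v u.
Proof.
move=> vub; case: (leqP (size (rcons u b)) (size v)) => [uv|].
  by left; apply: tree_le_size_eq.
rewrite size_rcons ltnS => vu; right.
case: (tree_le_total_below vub (tree_ltW (tree_lt_rcons u b))) => // uv.
by rewrite -(tree_le_size_eq uv vu); apply: prefix_refl.
Qed.

(** The node [w] is the longest common initial segment. This reduces incomparability to siblings,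
    which a recursive construction can control. *)
Lemma incomparable_split (u v : dyadic) : incomparable u v ->
  exists w b, tree_le (rcons w b) u /\ tree_le (rcons w (~~ b)) v.
Proof.
elim: u v => [|b u IH] [|c v] [uv vu].
- by case: uv.
- by case: uv.
- by case: vu.
case: (eqVneq b c) => [bc|nbc].
  rewrite /tree_le !prefix_cons bc eqxx /= in uv vu.
  have [w [d [wu wv]]] := IH v (conj uv vu).
  by exists (c :: w), d; rewrite /tree_le !rcons_cons !prefix_cons bc eqxx.
exists [::], b; rewrite /tree_le /= !eqxx !prefix0s.
by case: b c nbc {uv vu} => [] [].
Qed.

(** * Embedded copies of the tree, and perfect sets *)

Definition embedding (f : dyadic -> dyadic) : Prop :=
  forall u v, tree_le (f u) (f v) = tree_le u v.

Section Embedding.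
Variable f : dyadic -> dyadic.
Hypothesis f_emb : embedding f.

Lemma embedding_inj : injective f.
Proof.
move=> u v fuv; apply: tree_le_anti; rewrite -f_emb fuv; exact: prefix_refl.
Qed.

Lemma embedding_lt (u v : dyadic) : tree_lt (f u) (f v) = tree_lt u v.
Proof. by rewrite /tree_lt f_emb (inj_eq embedding_inj). Qed.

Lemma embedding_incomparable (u v : dyadic) :
  incomparable u v -> incomparable (f u) (f v).
Proof. by rewrite /incomparable !f_emb. Qed.

Lemma subtree_range : subtree (range f).
Proof.
split.
  exists (f [::]); split=> [|m [[u _ <-] /(_ (f [::]))]].
    split=> [|_ [u _ <-]]; first by exists [::].
    by rewrite f_emb /tree_le prefixs0 => /eqP->.
  by apply; [exists [::]|rewrite f_emb; exact: prefix0s].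
move=> _ [u _ <-]; exists (f (rcons u true)), (f (rcons u false)); split.
  by move/embedding_inj/eqP; rewrite eqseq_rcons eqxx.
have succ b : immediate_successors (range f) (f u) (f (rcons u b)).
  split=> [|_ [[v _ <-]]].
    by split; [exists (rcons u b)|rewrite embedding_lt tree_lt_rcons].
  rewrite embedding_lt f_emb => /tree_lt_rconsP[c cv] vb; congr f.
  apply: tree_le_size_eq vb _; move/size_prefix: cv.
  by rewrite !size_rcons.
apply/seteqP; split=> [m [[[v _ <-]]]|_ [->|->]]; last 2 first.
- exact: succ.
- exact: succ.
rewrite embedding_lt => /tree_lt_rconsP[b bv] min_v.
have -> : f v = f (rcons u b).
  apply/esym/min_v; last by rewrite f_emb.
  by have [] := succ b.
by case: b {bv}; [left|right].
Qed.

End Embedding.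

(** The reservoirs. This is weaker than being a subtree and, unlike it, survives restriction to the
    elements strictly above a given one, where several minimal elements may appear. *)
Definition perfect (R : set dyadic) : Prop :=
  (exists t, R t) /\
  (forall t, R t -> exists a b,
     [/\ R a, R b, tree_lt t a, tree_lt t b & incomparable a b]).

Lemma perfect_setT : perfect [set: dyadic].
Proof.
split=> [|t _]; first by exists [::].
exists (rcons t true), (rcons t false).
by split=> //; try exact: tree_lt_rcons; apply: (incomparable_rcons t true).
Qed.

Definition above (t : dyadic) : set dyadic := [set x | tree_lt t x].

Lemma perfect_range (f : dyadic -> dyadic) : embedding f -> perfect (range f).
Proof.
move=> fe; split=> [|_ [u _ <-]]; first by exists (f [::]), [::].
exists (f (rcons u true)), (f (rcons u false)); split; try by eexists.
- by rewrite embedding_lt ?tree_lt_rcons.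
- by rewrite embedding_lt ?tree_lt_rcons.
by apply: embedding_incomparable => //; apply: (incomparable_rcons u true).
Qed.

Lemma perfect_above (R : set dyadic) (t : dyadic) :
  perfect R -> R t -> perfect (R `&` above t).
Proof.
move=> [_ Rs] Rt; split.
  by have [a [_ [Ra _ ta _ _]]] := Rs _ Rt; exists a.
move=> u [Ru tu]; have [a [b [Ra Rb ua ub ab]]] := Rs _ Ru.
by exists a, b; split=> //; split=> //; apply: tree_lt_trans tu _.
Qed.

Lemma perfect_from (R : set dyadic) (t : dyadic) :
  perfect R -> R t -> perfect (R `&` [set x | tree_le t x]).
Proof.
move=> [_ Rs] Rt; split; first by exists t; split=> //; apply: prefix_refl.
move=> u [Ru tu]; have [a [b [Ra Rb ua ub ab]]] := Rs _ Ru.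
by exists a, b; split=> //; split=> //; apply: prefix_trans tu (tree_ltW _).
Qed.

Lemma perfect_sequence (R : set dyadic) : perfect R ->
  exists l : nat -> dyadic, forall j, R (l j) /\ tree_lt (l j) (l j.+1).
Proof.
move=> [[t Rt] Rs].
have [x|g gP] := @choice _ _ (fun x y => R x -> R y /\ tree_lt x y).
  case: (pselect (R x)) => [Rx|]; last by exists x.
  by have [a [_ [Ra _ xa _ _]]] := Rs _ Rx; exists a.
have Rg j : R (iter j g t) by elim: j => //= j /gP[].
by exists (fun j => iter j g t) => j; split=> //; have [] := gP _ (Rg j).
Qed.

(** * Fusion along all branches *)

Section Fusion.
Variable P : seq dyadic -> set dyadic -> Prop.
Hypothesis P_sub : forall s R R', R' `<=` R -> P s R -> P s R'.
Hypothesis P_step : forall s R, perfect R -> P s R ->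
  exists m R', [/\ R m, perfect R', R' `<=` R `&` above m & P (rcons s m) R'].

(* The elements below the node in increasing order, the element at the node, and
   the reservoir for the elements above it. *)
Let node := (seq dyadic * dyadic * set dyadic)%type.
Let valid (x : node) : Prop :=
  [/\ sorted tree_lt (rcons x.1.1 x.1.2), perfect x.2, x.2 `<=` above x.1.2 &
      P (rcons x.1.1 x.1.2) x.2].
Let extends (x y : node) : Prop :=
  [/\ valid y, y.1.1 = rcons x.1.1 x.1.2, x.2 y.1.2 & y.2 `<=` x.2].

(** The set [R] prescribes where the new element lies; choosing it inside two incomparable cones
    makes siblings incomparable. *)
Let extend (x : node) (R : set dyadic) : valid x -> perfect R -> R `<=` x.2 ->
  exists2 y, extends x y & R y.1.2.
Proof.
move=> [xs px xa xP] pR Rx.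
have [m [R' [Rm pR' R'R PR']]] := P_step pR (P_sub Rx xP).
exists (rcons x.1.1 x.1.2, m, R') => //; split=> //=; first split=> //=.
- by rewrite -cats1 cat_rcons sorted_cat_cons xs /= andbT; apply/xa/Rx.
- by move=> t /R'R[].
- exact: Rx.
- by move=> t /R'R[Rt _]; apply: Rx.
Qed.

(** [P_step] is run separately for the two children of every node, with reservoirs decreasing along
    each branch. The list [s] collects the values of [f] strictly below [t], so [P] controls every
    finite chain up to [t]. *)
Lemma fusion (R : set dyadic) : perfect R -> P [::] R ->
  exists f, [/\ embedding f, range f `<=` R &
    forall t, range f t -> exists s, P (rcons s t) (range f `&` above t) /\
      forall c, sorted tree_lt c -> (forall x, x \in c -> range f x) ->
        (forall x, x \in c -> tree_le x t) -> subseq c (rcons s t)].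
Proof.
move=> pR PR.
have [x0 [vx0 x0s x0R x0R']] : exists x0 : node,
    [/\ valid x0, x0.1.1 = [::], R x0.1.2 & x0.2 `<=` R].
  have [m [R' [Rm pR' R'R PR']]] := P_step pR PR.
  exists ([::], m, R'); split=> //=; last by move=> t /R'R[].
  by split=> //= t /R'R[].
have [x|next nextP] := @choice node (bool -> node) (fun x y => valid x ->
    (forall b, extends x (y b)) /\ incomparable (y true).1.2 (y false).1.2).
  case: (pselect (valid x)) => [vx|]; last by exists (fun=> x).
  have [_ px _ _] := vx; have [[t xt] /(_ _ xt)] := px.
  move=> [a [b [xa xb _ _ ab]]].
  have [|y xy [_ ay]] := extend vx (perfect_from px xa); first by move=> ? [].
  have [|z xz [_ bz]] := extend vx (perfect_from px xb); first by move=> ? [].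
  exists (fun c => if c then y else z) => _; split; first by case.
  exact: incomparable_le ab ay bz.
pose N (u : dyadic) := foldl next x0 u.
have N_rcons u b : N (rcons u b) = next (N u) b by rewrite /N foldl_rcons.
have validN u : valid (N u).
  elim/last_ind: u => [//|u b IH]; rewrite N_rcons.
  by have [/(_ b)[]] := nextP _ IH.
pose f u := (N u).1.2.
have ext u b : extends (N u) (N (rcons u b)).
  by rewrite N_rcons; have [/(_ b)] := nextP _ (validN u).
have N_le u v : tree_le u v -> (N v).2 `<=` (N u).2.
  case/prefixP=> w ->; elim/last_ind: w => [|w b IH]; first by rewrite cats0.
  by rewrite -rcons_cat; have [_ _ _ sub] := ext (u ++ w) b => t /sub/IH.
have N_lt u v : tree_lt u v -> (N u).2 (f v).
  case/andP=> /prefixP[w ->]; elim/last_ind: w => [|w b _ _].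
    by rewrite cats0 eqxx.
  rewrite -rcons_cat; have [_ _ + _] := ext (u ++ w) b.
  by apply: N_le; apply: prefix_prefix.
have f_lt u v : tree_lt u v -> tree_lt (f u) (f v).
  by move=> /N_lt; have [_ _ sub _] := validN u; apply: sub.
have f_le u v : tree_le u v -> tree_le (f u) (f v).
  by case/tree_le_eqVlt=> [->|/f_lt/tree_ltW //]; apply: prefix_refl.
(* At the first disagreement the two siblings were chosen incomparable, and this passes to
   everything above them. *)
have f_inc u v : incomparable u v -> incomparable (f u) (f v).
  move=> /incomparable_split[w [b [/f_le wu /f_le wv]]].
  suff : incomparable (f (rcons w b)) (f (rcons w (~~ b))).
    by move=> H; apply: incomparable_le H wu wv.
  have [_] := nextP _ (validN w); rewrite /f !N_rcons.
  by case: b {wu wv} => //= -[].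
have fe : embedding f.
  move=> u v; apply/idP/idP => [fuv|]; last exact: f_le.
  case: (boolP (tree_le u v)) => // /negP uv.
  case: (boolP (tree_le v u)) => [vu|/negP vu].
    have fE := tree_le_anti fuv (f_le _ _ vu).
    case: (tree_le_eqVlt vu) => [vE|/f_lt]; last by rewrite fE tree_lt_irr.
    by case: uv; rewrite vE; apply: prefix_refl.
  by have [] := f_inc u v (conj uv vu).
have fR u : R (f u).
  case: u => // b u; apply: x0R'; apply: (N_lt [::]); rewrite /tree_lt andbT.
  exact: prefix0s.
exists f; split=> // [_ [u _ <-] //|_ [u _ <-]].
have [sorted_u _ _ Pu] := validN u.
exists (N u).1.1; split.
  (* Elements of the range above [f u] are values at proper extensions of [u], hence lie in the
     reservoir of [N u]. *)
  apply: P_sub Pu => _ [[v _ <-]]; rewrite /above /= embedding_lt //.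
  exact: N_lt.
move=> c sorted_c cf cu; apply: sorted_tree_lt_subseq => // x xc.
have [[v _ vx] xu] := (cf _ xc, cu _ xc).
(* The recorded list consists of the values at all initial segments of [u]. *)
suff : x \in rcons (N u).1.1 (f u) <-> exists2 v, tree_le v u & x = f v.
  by case=> _; apply; exists v; rewrite // -fe vx.
clear - x0s ext.
elim/last_ind: u => [|u b IH].
  rewrite [(N [::]).1.1]x0s inE; split=> [/eqP->|[v]].
    by exists [::] => //; apply: prefix_refl.
  by rewrite /tree_le prefixs0 => /eqP-> ->.
have [_ -> _ _] := ext u b; rewrite mem_rcons inE -/(f u).
split=> [/orP[/eqP->|/IH[v vu ->]]|[v vu xE]].
- by exists (rcons u b) => //; apply: prefix_refl.
- by exists v => //; apply: prefix_trans vu (prefix_rcons _ _).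
case: (tree_le_rcons vu) => [vE|vu']; first by rewrite xE vE eqxx.
by apply/orP; right; apply/IH; exists v.
Qed.

End Fusion.

(** * Finite bookkeeping and increasing sequences *)

Lemma subseq_rconsP (T : eqType) (A s : seq T) (m : T) :
  subseq A (rcons s m) ->
  subseq A s \/ exists2 A', A = rcons A' m & subseq A' s.
Proof.
rewrite -subseq_rev rev_rcons -(subseq_rev A s).
case/lastP: A => [|A a]; first by left; apply: sub0seq.
rewrite rev_rcons /=; case: eqP => [->|_]; last by left.
by rewrite subseq_rev; right; exists A.
Qed.

Lemma sublists (T : eqType) (s : seq T) :
  exists L : seq (seq T), forall c, subseq c s <-> c \in L.
Proof.
exists [seq mask (tval m) s | m <- enum {: (size s).-tuple bool}] => c.
split=> [/subseqP[m /eqP sm ->]|/mapP[m _ ->]]; last exact: mask_subseq.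
by apply/mapP; exists (Tuple sm); rewrite // mem_enum.
Qed.

(** Since [Q] is inherited by smaller reservoirs, finitely many requirements can be met one after
    another. *)
Lemma shrink_all (X : eqType) (Q : X -> set dyadic -> Prop) (L : seq X)
    (R : set dyadic) :
  (forall x R R', R' `<=` R -> Q x R -> Q x R') ->
  (forall x R', x \in L -> perfect R' -> R' `<=` R ->
     exists R'', [/\ perfect R'', R'' `<=` R' & Q x R'']) ->
  perfect R ->
  exists R', [/\ perfect R', R' `<=` R & forall x, x \in L -> Q x R'].
Proof.
move=> Q_sub; elim: L => [|x L IH] Q_step pR; first by exists R; split.
have [y R' yL|R' [pR' R'R QR']] := IH _ pR.
  by apply: Q_step; rewrite inE yL orbT.
have [R'' [pR'' R''R' QR'']] := Q_step x R' (mem_head _ _) pR' R'R.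
exists R''; split=> //; first exact: subset_trans R'R.
by move=> y; rewrite inE => /orP[/eqP-> //|/QR']; apply: Q_sub.
Qed.

Lemma increasing_lt (l : nat -> dyadic) :
  (forall j, tree_lt (l j) (l j.+1)) ->
  forall j k, (j < k)%N -> tree_lt (l j) (l k).
Proof. by move=> l_incr; apply: (homo_ltn tree_lt_trans). Qed.

Lemma chains_range (l : nat -> dyadic) :
  (forall j, tree_lt (l j) (l j.+1)) -> chains [set: dyadic] (range l).
Proof.
move=> /increasing_lt l_lt.
have l_inj : injective l.
  move=> j k ljk; case: (ltngtP j k) => [/l_lt|/l_lt|//];
    by rewrite ljk tree_lt_irr.
split=> //.
  move=> _ _ [j _ <-] [k _ <-].
  case: (ltngtP j k) => [/l_lt/tree_ltW ->|/l_lt/tree_ltW ->|->].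
  - by left.
  - by right.
  - by left; apply: prefix_refl.
move=> fin_l; apply: infinite_nat.
suff -> : [set: nat] = l @^-1` range l.
  by apply: finite_preimage fin_l => j k _ _; apply: l_inj.
by apply/seteqP; split=> // j _; exists j.
Qed.

Definition increasing_in (R : set dyadic) (l : nat -> dyadic) : Prop :=
  forall j, R (l j) /\ tree_lt (l j) (l j.+1).

(** * The Nash-Williams-Galvin dichotomy and the avoidance of an element *)

Section Galvin.
Variable B : set (seq dyadic).

(** The value [q = 0] is allowed, so a list in [B] is accepted by every reservoir. *)
Let accepts (s : seq dyadic) (R : set dyadic) : Prop :=
  forall l, increasing_in R l -> exists q, B (s ++ mkseq l q).
Let rejects (s : seq dyadic) (R : set dyadic) : Prop :=
  forall R', perfect R' -> R' `<=` R -> ~ accepts s R'.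

Let rejects_sub s R R' : R' `<=` R -> rejects s R -> rejects s R'.
Proof.
by move=> R'R rej R'' pR'' R''R'; apply: rej => //; apply: subset_trans R'R.
Qed.

(** Otherwise every perfect subset of [R] has an element [m] and, above it, a perfect part accepting
    [rcons s m]. Fusing these choices gives a perfect set that accepts [s], since the first term of
    any of its sequences is such an [m]. *)
Let rejects_step s R : perfect R -> rejects s R -> exists R',
  [/\ perfect R', R' `<=` R &
      forall m, R' m -> rejects (rcons s m) (R' `&` above m)].
Proof.
move=> pR rej; apply: contrapT => noR'.
(* Only the last element of [t] matters; the guard makes the default of [last] harmless. *)
pose P (t : seq dyadic) R' := R' `<=` R /\
  (t <> [::] -> accepts (rcons s (last [::] t)) R').
have P_sub t R1 R2 : R2 `<=` R1 -> P t R1 -> P t R2.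
  move=> R21 [R1R acc]; split; first exact: subset_trans R1R.
  by move=> /acc{}acc l lR2; apply: acc => j; have [/R21] := lR2 j.
have P_step t R1 : perfect R1 -> P t R1 -> exists m R',
    [/\ R1 m, perfect R', R' `<=` R1 `&` above m & P (rcons t m) R'].
  move=> pR1 [R1R _]; apply: contrapT => nom; apply: noR'.
  exists R1; split=> // m R1m R' pR' R'R1 acc; apply: nom.
  exists m, R'; split=> //; split; last by rewrite last_rcons.
  by move=> t' /R'R1[/R1R].
have [|f [fe fR fP]] := fusion P_sub P_step pR; first by split.
apply: (rej (range f)) => //; first exact: perfect_range.
move=> l lf; have [l0f _] := lf 0.
have [w [[_ acc] _]] := fP _ l0f.
have [||q] := acc _ (fun j => l j.+1).
  by move/(congr1 size); rewrite size_rcons.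
  move=> j; have [lj lj1] := lf j.+1; split=> //; split=> //.
  exact: increasing_lt (fun j => (lf j).2) _ _ _.
(* The term [l 0] precedes the [q] terms of the shifted sequence. *)
rewrite last_rcons => Bq; exists q.+1.
by rewrite /mkseq /= (iotaDl 1 0) -map_comp -cat_rcons.
Qed.

(** If no perfect subset accepts the empty list, fuse while keeping all subsequences of the current
    chain rejected. A finite chain of the result cannot lie in [B], as it would be both accepted and
    rejected. *)
Lemma galvin (R : set dyadic) : perfect R -> exists R',
  [/\ perfect R', R' `<=` R &
    (forall l, increasing_in R' l -> exists q, B (mkseq l q)) \/
    (forall s, sorted tree_lt s -> (forall x, x \in s -> R' x) -> ~ B s)].
Proof.
move=> pR.
case: (pselect (exists R', [/\ perfect R', R' `<=` R & accepts [::] R'])).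
  by case=> R' [pR' R'R acc]; exists R'; split=> //; left.
move=> noR'; have rej : rejects [::] R.
  by move=> R' pR' R'R acc; apply: noR'; exists R'.
pose P (s : seq dyadic) R' := forall c, subseq c s -> rejects c R'.
have P_sub s R1 R2 : R2 `<=` R1 -> P s R1 -> P s R2.
  by move=> R21 PR1 c cs; apply: rejects_sub R21 (PR1 c cs).
have P_step s R1 : perfect R1 -> P s R1 -> exists m R',
    [/\ R1 m, perfect R', R' `<=` R1 `&` above m & P (rcons s m) R'].
  move=> pR1 PR1; have [L LP] := sublists s.
  (* The next element has to work for all subsequences [c] of [s] at once, so the reservoir is first
     thinned for each of them. *)
  pose Q c R' := forall m, R' m -> rejects (rcons c m) (R' `&` above m).
  have [c R2 R3 R32 QR2 m R3m|c R2 /LP cs pR2 R21|//|R2 [pR2 R21 QR2]] :=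
      @shrink_all _ Q L R1.
  - by apply: rejects_sub (QR2 m (R32 _ R3m)); apply: setSI.
  - exact/rejects_step/(rejects_sub R21)/PR1.
  have [[m R2m] _] := pR2; exists m, (R2 `&` above m); split.
  - exact: R21.
  - exact: perfect_above.
  - exact: setSI.
  move=> c /subseq_rconsP[cs|[c' -> /LP c'L]]; last exact: QR2.
  by apply: rejects_sub (PR1 c cs) => t [/R21].
have [|f [fe fR fP]] := fusion P_sub P_step pR.
  by move=> c; rewrite subseq0 => /eqP->.
exists (range f); split=> //; first exact: perfect_range.
right=> s sorted_s sf Bs.
have accs R' : accepts s R' by move=> l _; exists 0; rewrite cats0.
case/lastP: s sorted_s sf Bs accs => [|s t] sorted_s sf _ accs.
  exact: (rej (range f)) (perfect_range fe) fR (accs _).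
have tf : range f t by apply: sf; rewrite mem_rcons mem_head.
have [w [Pw /(_ (rcons s t) sorted_s sf) sw]] := fP _ tf.
apply: (Pw _ (sw _) (range f `&` above t)) => //.
  by move=> x; apply: sorted_tree_lt_le_last.
by apply: perfect_above => //; apply: perfect_range.
Qed.

End Galvin.

(** In the application [F i] is the union of the sets of index [i], [G i] the one with the
    prescribed [k], and [J] what is already secured on the finite chain below [m]. *)
Lemma avoid_elements (I : Type) (J : set I) (F G : I -> set dyadic)
    (R : set dyadic) :
  (forall l, (forall j, tree_lt (l j) (l j.+1)) ->
    exists r, forall i, ~ forall j, (j < r)%N -> F i (l j)) ->
  perfect R -> exists R', [/\ perfect R', R' `<=` R &
    forall m C, R' m -> (forall x, x \in C -> R' x) ->
      sorted tree_lt (m :: C) ->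
      (exists2 i, J i & forall x, x \in C -> G i x) ->
      exists i, [/\ J i, forall x, x \in C -> G i x & ~ F i m]].
Proof.
move=> F_bounded pR.
pose bad (m : dyadic) (C : seq dyadic) :=
  (exists2 i, J i & forall x, x \in C -> G i x) /\
  forall i, J i -> (forall x, x \in C -> G i x) -> F i m.
have [R' [pR' R'R [all_bad|no_bad]]] :=
    galvin [set s | exists m C, s = m :: C /\ bad m C] pR; last first.
  exists R'; split=> // m C R'm R'C sorted_mC exC.
  apply: contrapT => noi; apply: (no_bad (m :: C)) => //.
    by move=> x; rewrite inE => /orP[/eqP->|/R'C].
  exists m, C; split=> //; split=> // i Ji iC.
  by apply: contrapT => nFim; apply: noi; exists i.
have [l lR'] := perfect_sequence pR'.
have [r rP] := F_bounded l (fun j => (lR' j).2).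
have l_lt := increasing_lt (fun j => (lR' j).2).
(* Replace the first term of [l] by any of the first [r.+1] ones, while keeping
   the terms after these. *)
have [j|q qP] := @choice 'I_r.+1 nat
    (fun j q => bad (l j) (mkseq (fun k => l (r.+1 + k)%N) q)).
  pose l' k := if k is k'.+1 then l (r.+1 + k')%N else l j.
  have [k|[|q] [m [C [//= [<- <-] bad_jq]]]] := all_bad l'.
    split; first by case: k => [|k]; apply: (lR' _).1.
    by case: k => [|k] /=; apply: l_lt; rewrite ?addnS // addn0.
  exists q; congr (bad _ _): bad_jq.
  by rewrite (iotaDl 1 0) -map_comp.
(* The tails are nested, so a [G i] containing the longest contains all of them, and each
   obstruction then puts [l j] into [F i]. With [r.+1] indices the maximum is over a nonempty set
   even for [r = 0]. *)
case: (@arg_maxnP _ ord0 xpredT q) => // j0 _ q_max.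
have [[i Ji iC] _] := qP j0.
case: (rP i) => j jr.
have [_ /(_ i Ji)] := qP (Ordinal (ltnW jr : (j < r.+1)%N)).
apply=> x /mapP[k]; rewrite mem_iota /= => kq ->; apply: iC.
apply/mapP; exists k => //; rewrite mem_iota /=.
exact: leq_trans kq (q_max _ _).
Qed.

(** * Compactness of the power set *)

Lemma closure_contains_sequence (I : Type) (F : I -> set dyadic)
    (x : nat -> dyadic) :
  (forall r, exists i, forall j, (j < r)%N -> F i (x j)) ->
  exists2 G, powerset_closure (range F) G & forall j, G (x j).
Proof.
move=> /choice[f fP].
have cpt : compact [set: {ptws dyadic -> bool}].
  have := @tychonoff _ (fun _ : dyadic => bool) _ (fun=> bool_compact).
  by congr (compact _); apply/seteqP; split.
(* A cluster point of the characteristic functions of the [F (f r)]; its support is the required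
   [G]. *)
have [p [_ clp]] := cpt ((char_fun \o F \o f) @ \oo) _ filterT.
exists [set t | p t].
  rewrite /powerset_closure /=.
  have -> : char_fun [set t | p t] = p.
    by apply/funext => t; rewrite /char_fun; apply/idP/idP; rewrite inE.
  move=> V Vp.
  have near_range : \forall r \near \oo,
      range (char_fun \o F \o f) ((char_fun \o F \o f) r).
    by apply: (filterE eventually_filter) => r; exists r.
  have [q [[j _ <-] Vq]] := clp _ V near_range Vp.
  exists (char_fun (F (f j))); split=> //.
  by exists (F (f j)) => //; exists (f j).
move=> j /=.
have near_mem : \forall r \near \oo, char_fun (F (f r)) (x j).
  apply: (filterS _ (nbhs_infty_gt j)) => r jr.
  by rewrite /char_fun inE; apply: fP.
(* Evaluation at [x j] is continuous into a discrete space, so [p] agrees at [x j] with some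
   function that is true there. *)
have [|q []] := clp [set g | g (x j)] [set g | g (x j) = p (x j)] near_mem.
  have := @proj_continuous _ (fun _ : dyadic => bool) (x j) p [set p (x j)].
  by apply; rewrite nbhs_principalE; apply/principal_filterP.
by move=> /= + <-.
Qed.

(** * Preservation of adequacy and extraction of the subtree *)

Theorem theorem2p3 (I : Type) (n : nat) (n_gt0 : (0 < n)%N)
    (F : I -> 'I_n -> set dyadic)
    (F_finite : forall (i : I) (k : 'I_n), finite_set (F i k))
    (F_closure : forall G : set dyadic,
       powerset_closure (range (fun i : I => \bigcup_(k in [set: 'I_n]) F i k)) G ->
       forall beta : set dyadic, chains [set: dyadic] beta ->
       finite_set (G `&` beta)) :
  exists T : set dyadic, subtree T /\
    forall (beta : set dyadic) (s : nat -> dyadic),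
      chains T beta -> increasing_enumeration beta s ->
    forall (i : I) (q : nat) (k : 'I_n) (A : set dyadic),
      A `<=` F i k `&` (s @` `I_q) ->
    exists i' : I,
      F i' k `&` (s @` `I_q) = A /\
      forall k' : 'I_n, k' <> k -> F i' k' `&` (s @` `I_q) `<=` A.
Proof.
pose U i := \bigcup_(k in [set: 'I_n]) F i k.
have FU i k x : F i k x -> U i x by exists k.
(* A failure puts arbitrarily long initial segments of [l] into members of the family; by
   compactness a set of the closure contains the whole infinite chain. *)
have U_bounded l : (forall j, tree_lt (l j) (l j.+1)) ->
    exists r, forall i, ~ forall j, (j < r)%N -> U i (l j).
  move=> l_incr; apply: contrapT => no_r.
  have [r|G clG Gl] := @closure_contains_sequence _ U l.
    apply: contrapT => noi; apply: no_r; exists r => i iP.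
    by apply: noi; exists i.
  have chain_l := chains_range l_incr.
  case: (chain_l) => _ _; apply; rewrite -[range l](@setIidr _ G).
    exact: F_closure.
  by move=> _ [j _ <-].
(* Adequacy. The list [C] stands for elements that may join the chain later. *)
pose P (s : seq dyadic) (R : set dyadic) := forall A k C,
  subseq A s -> sorted tree_lt C -> (forall x, x \in C -> R x) ->
  (exists i, forall x, x \in A ++ C -> F i k x) ->
  exists i', (forall x, x \in s -> U i' x -> x \in A) /\
    forall x, x \in A ++ C -> F i' k x.
have P_sub s R R' : R' `<=` R -> P s R -> P s R'.
  by move=> R'R PR A k C As sC CR'; apply: PR => // x /CR'/R'R.
have P_step s R : perfect R -> P s R -> exists m R',
    [/\ R m, perfect R', R' `<=` R `&` above m & P (rcons s m) R'].
  move=> pR PR; have [L LP] := sublists s.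
  (* [J] records what adequacy of [s] yields for [A]. There are finitely many pairs [(A, k)], so one
     thinning serves them all. *)
  pose J (A : seq dyadic) k i :=
    (forall x, x \in s -> U i x -> x \in A) /\ forall x, x \in A -> F i k x.
  pose Q (Ak : seq dyadic * 'I_n) R' := forall m C, R' m ->
    (forall x, x \in C -> R' x) -> sorted tree_lt (m :: C) ->
    (exists2 i, J Ak.1 Ak.2 i & forall x, x \in C -> F i Ak.2 x) ->
    exists i, [/\ J Ak.1 Ak.2 i, forall x, x \in C -> F i Ak.2 x & ~ U i m].
  have [Ak R1 R2 R21 QR1 m C R2m CR2||//|R' [pR' R'R QR']] :=
      @shrink_all _ Q [seq (A, k) | A <- L, k <- enum 'I_n] R.
  - by apply: QR1 => [|x /CR2]; apply: R21.
  - by move=> Ak R1 _ pR1 _; apply: avoid_elements.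
  have [[m R'm] _] := pR'; exists m, (R' `&` above m); split.
  - exact: R'R.
  - exact: perfect_above.
  - exact: setSI.
  move=> A k C Asm sC CR' [i AC].
  (* If [A] lies in [s], adequacy of [s] supplies a member satisfying [J], and [QR'] replaces it by
     one that also avoids [m]. If [A] ends with [m], move [m] to the front of [C] and use adequacy
     for [A']. *)
  case/subseq_rconsP: Asm AC => [As|[A' -> A's]] AC.
    have [|i1 [i1A i1AC]] := PR A k C As sC _ (ex_intro _ i AC).
      by move=> x /CR'[/R'R].
    have [||||i2 [[i2s i2A] i2C i2m]] := QR' (A, k) _ m C R'm.
    - by apply/allpairsP; exists (A, k); split; [apply/LP|rewrite mem_enum|].
    - by move=> x /CR'[].
    - by rewrite /= path_min_sorted //; apply/allP => x /CR'[].
    - exists i1 => [|x xC]; last by apply: i1AC; rewrite mem_cat xC orbT.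
      by split=> // x xA; apply: i1AC; rewrite mem_cat xA.
    exists i2; split=> x.
      by rewrite mem_rcons inE => /orP[/eqP->|/i2s].
    by rewrite mem_cat => /orP[/i2A|/i2C].
  rewrite cat_rcons in AC *.
  have [||i1 [i1A i1AC]] := PR A' k (m :: C) A's _ _ (ex_intro _ i AC).
  - by rewrite /= path_min_sorted //; apply/allP => x /CR'[].
  - by move=> x; rewrite inE => /orP[/eqP->|/CR'[]]; [exact: R'R|move/R'R].
  exists i1; split=> // x; rewrite !mem_rcons !inE.
  by case: (x == m) => //= /i1A.
have [|f [fe _ fP]] := fusion P_sub P_step perfect_setT.
  move=> A k C; rewrite subseq0 => /eqP-> _ _ [i iC].
  by exists i.
exists (range f); split; first exact: subtree_range.
(* An empty segment has no last element at which to use the fusion, so it is treated apart. *)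
move=> beta s [beta_f _ _] [s_incr s_range] i [|q] k A A_sub.
  exists i; have -> : A = set0.
    by apply/seteqP; split=> // x /A_sub[_ []].
  by rewrite II0 image_set0; split=> [|k' _]; rewrite setI0.
have sf j : range f (s j) by apply: beta_f; rewrite -s_range; exists j.
have s_lt := increasing_lt s_incr.
(* Numbering starts at 0, so the last of these [q.+1] terms is [s q]. *)
pose c := mkseq s q.+1.
have c_sorted : sorted tree_lt c.
  exact: (homo_sorted s_lt) (iota_ltn_sorted 0 q.+1).
have [w [Pw /(_ c c_sorted) cw]] := fP _ (sf q).
have {}cw : subseq c (rcons w (s q)).
  apply: cw => x /mapP[j]; rewrite mem_iota ltnS /= => jq ->; first exact: sf.
  move: jq; rewrite leq_eqVlt => /orP[/eqP->|/s_lt/tree_ltW //].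
  exact: prefix_refl.
have cE x : (s @` `I_q.+1) x <-> x \in c.
  split=> [[j jq <-]|/mapP[j]]; first by apply: map_f; rewrite mem_iota.
  by rewrite mem_iota => jq ->; exists j.
pose Al := [seq x <- c | x \in A].
have AlP x : (x \in Al) <-> A x.
  rewrite mem_filter; split=> [/andP[/set_mem] //|Ax].
  by rewrite (mem_set Ax) /=; apply/cE; have [] := A_sub _ Ax.
have [||i' [i'w i'A]] := Pw Al k [::] (subseq_trans (filter_subseq _ _) cw) isT.
- by [].
- by exists i => x; rewrite cats0 => /AlP/A_sub[].
(* The whole union meets the segment inside [A]; this gives (ii) and one inclusion of (i). *)
have U_A k' x : F i' k' x -> (s @` `I_q.+1) x -> A x.
  by move=> /FU Fx /cE/(mem_subseq cw) xw; apply/AlP/i'w.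
exists i'; split=> [|k' _ x [/U_A]]; last exact.
apply/seteqP; split=> [x [/U_A]|x Ax]; first exact.
split; last by have [] := A_sub _ Ax.
by apply: i'A; rewrite cats0; apply/AlP.
Qed.
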